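(* Let $M\subset\mathbb{C}^9$ be the quadratic submanifold of real codimension $5$ given in the coordinates $(z_1,z_2,z_1',z_2',w_1,w_2,w_3,w_4,w_1')$ by $$\operatorname{Im} w_1= z_1\bar z_2+z_2\bar z_1,\qquad \operatorname{Im} w_2=-i z_1\bar z_2+i z_2\bar z_1,\qquad \operatorname{Im} w_3=z_1\bar z_1,\qquad \operatorname{Im} w_4=z_2\bar z_2,$$ $$\operatorname{Im} w_1'= z_1\bar z_2'+z_2'\bar z_1+z_2\bar z_1'+z_1'\bar z_2 .$$ Then $M$ admits a nonzero infinitesimal CR automorphism at $0$ which is weighted homogeneous of weighted order $6$ and whose coefficients are homogeneous polynomials of degree $4$. Explicitly, such a vector field is \begin{align*} & (-3w_1^4-6w_1^2w_2^2+24w_1^2w_3w_4-3w_2^4+24w_2^2w_3w_4-48w_3^2w_4^2)\frac{\partial}{\partial w_1'}\\ &+(2w_1^3+2w_1w_2^2-8w_1w_3w_4)\Big(2w_1\frac{\partial}{\partial w_1'}+z_1\frac{\partial}{\partial z_1'}+z_2\frac{\partial}{\partial z_2'}\Big)\\ &+(2w_1^2w_2+2w_2^3-8w_2w_3w_4)\Big(2w_2\frac{\partial}{\partial w_1'}-iz_1\frac{\partial}{\partial z_1'}+iz_2\frac{\partial}{\partial z_2'}\Big)\\ &+(-4w_1^2w_3-4w_2^2w_3+16w_3^2w_4)\Big(2w_4\frac{\partial}{\partial w_1'}+z_2\frac{\partial}{\partial z_1'}\Big)\\ &+(-4w_1^2w_4-4w_2^2w_4+16w_3w_4^2)\Big(2w_3\frac{\partial}{\partial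 w_1'}+z_1\frac{\partial}{\partial z_2'}\Big). \end{align*}
   Context: An infinitesimal CR automorphism of $M$ at $0$ is a germ at $0$ of a holomorphic vector field on $\mathbb{C}^9$ whose real part is tangent to $M$ along $M$. Weights: every variable $z_j,z_j'$ has weight $1$, every variable $w_j,w_j'$ has weight $2$, $\partial/\partial z_j,\partial/\partial z_j'$ have weight $-1$ and $\partial/\partial w_j,\partial/\partial w_j'$ have weight $-2$; a vector field is weighted homogeneous of weighted order $b$ if all its terms have total weight $b$. ''Homogeneous polynomial of degree $4$'' refers to the ordinary degree in all variables (a zero coefficient being allowed). *)

(* Defs.v *)
From HB Require Import structures.
From mathcomp Require Import all_boot all_order all_algebra.
From mathcomp Require Import complex.
From mathcomp Require Import mpoly.
From mathcomp Require Import boolp classical_sets reals topology normedtype derive.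

Set Implicit Arguments.
Unset Strict Implicit.
Unset Printing Implicit Defensive.

Import Order.TTheory GRing.Theory Num.Theory.
Import numFieldNormedType.Exports.
Local Open Scope classical_set_scope.
Local Open Scope ring_scope.

(* [complex R] bundled as a [numClosedFieldType]: its topology, used below in
   [near] and [differentiable], is then the one every numeric field carries. *)
Definition Cplx (R : realType) : numClosedFieldType := complex R.

Definition C9 (R : realType) : normedModType (Cplx R) := 'rV[Cplx R]_9.

(* Order of the coordinates: z1, z2, z1', z2', w1, w2, w3, w4, w1'. *)
Definition iz1 : 'I_9 := @Ordinal 9 0 isT.
Definition iz2 : 'I_9 := @Ordinal 9 1 isT.
Definition iz1' : 'I_9 := @Ordinal 9 2 isT.
Definition iz2' : 'I_9 := @Ordinal 9 3 isT.
Definition iw1 : 'I_9 := @Ordinal 9 4 isT.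
Definition iw2 : 'I_9 := @Ordinal 9 5 isT.
Definition iw3 : 'I_9 := @Ordinal 9 6 isT.
Definition iw4 : 'I_9 := @Ordinal 9 7 isT.
Definition iw1' : 'I_9 := @Ordinal 9 8 isT.

Definition quadricM (R : realType) : set (C9 R) :=
  [set p | let z1 := p 0 iz1 in let z2 := p 0 iz2 in
           let z1' := p 0 iz1' in let z2' := p 0 iz2' in
           [/\ 'Im (p 0 iw1) = z1 * z2^* + z2 * z1^*,
               'Im (p 0 iw2) = - 'i * z1 * z2^* + 'i * z2 * z1^*,
               'Im (p 0 iw3) = z1 * z1^*,
               'Im (p 0 iw4) = z2 * z2^*
             & 'Im (p 0 iw1') = z1 * z2'^* + z2' * z1^*
                                + z2 * z1'^* + z1' * z2^*]].

Arguments quadricM R : clear implicits.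

(* The tangent vectors at [p] to a real submanifold [M] of C^9 = R^18: the
   velocities at time 0 of the curves in [M] through [p]. *)
Definition tangent_vector (R : realType) (M : set (C9 R)) (p v : C9 R) : Prop :=
  exists gamma : R -> C9 R,
    [/\ gamma 0 = p,
        \forall t \near (0 : R), M (gamma t)
      & forall j : 'I_9,
          is_derive (0 : R) 1 (fun t => complex.Re (gamma t 0 j))
                    (complex.Re (v 0 j)) /\
          is_derive (0 : R) 1 (fun t => complex.Im (gamma t 0 j))
                    (complex.Im (v 0 j))].

(* [X p] lists the coefficients at [p] of the field sum_j X_j d/dzeta_j. With
   zeta_j = x_j + i y_j, its real part is
   1/2 sum_j (Re X_j d/dx_j + Im X_j d/dy_j),
   that is, [2^-1 *: X p] once C^9 is identified with R^18. *)
Definition real_part (R : realType) (X : C9 R -> C9 R) (p : C9 R) : C9 R :=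
  2^-1 *: X p.

(* [X] represents a germ at 0, so each condition is imposed near 0 only;
   differentiability is over the complex numbers, so it means holomorphy. *)
Definition infinitesimal_CR_automorphism (R : realType) (M : set (C9 R))
    (X : C9 R -> C9 R) : Prop :=
  (\forall p \near (0 : C9 R), differentiable X p) /\
  (\forall p \near (0 : C9 R), M p -> tangent_vector M p (real_part X p)).

Definition nonzero_germ (R : realType) (X : C9 R -> C9 R) : Prop :=
  ~ (\forall p \near (0 : C9 R), X p = 0).

(* [X 0 j] is the coefficient of the [j]-th coordinate field. *)
Definition poly_field (R : realType) := 'rV[{mpoly (Cplx R)[9]}]_9.

Definition eval_field (R : realType) (X : poly_field R) (p : C9 R) : C9 R :=
  \row_j (X 0 j).@[fun i => p 0 i].

Definition weight (j : 'I_9) : nat := if (j < 4)%N then 1 else 2.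

Definition weighted_homogeneous (R : realType) (b : int) (X : poly_field R) :
    Prop :=
  forall (j : 'I_9) (m : 'X_{1..9}), m \in msupp (X 0 j) ->
    (\sum_(i < 9) m i * weight i)%N%:Z - (weight j)%:Z = b.

Definition homogeneous_coefficients (R : realType) (d : nat)
    (X : poly_field R) : Prop :=
  forall j : 'I_9, X 0 j \is d.-homog.

Definition explicit_field (R : realType) : poly_field R :=
  let z1 := 'X_iz1 in let z2 := 'X_iz2 in
  let w1 := 'X_iw1 in let w2 := 'X_iw2 in
  let w3 := 'X_iw3 in let w4 := 'X_iw4 in
  let i : {mpoly (Cplx R)[9]} := 'i%:MP in
  let dz1' : poly_field R := delta_mx 0 iz1' in
  let dz2' : poly_field R := delta_mx 0 iz2' in
  let dw1' : poly_field R := delta_mx 0 iw1' in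
  (- 3 * w1 ^+ 4 - 6 * w1 ^+ 2 * w2 ^+ 2 + 24 * w1 ^+ 2 * w3 * w4
     - 3 * w2 ^+ 4 + 24 * w2 ^+ 2 * w3 * w4 - 48 * w3 ^+ 2 * w4 ^+ 2) *: dw1'
  + (2 * w1 ^+ 3 + 2 * w1 * w2 ^+ 2 - 8 * w1 * w3 * w4)
      *: ((2 * w1) *: dw1' + z1 *: dz1' + z2 *: dz2')
  + (2 * w1 ^+ 2 * w2 + 2 * w2 ^+ 3 - 8 * w2 * w3 * w4)
      *: ((2 * w2) *: dw1' - (i * z1) *: dz1' + (i * z2) *: dz2')
  + (- 4 * w1 ^+ 2 * w3 - 4 * w2 ^+ 2 * w3 + 16 * w3 ^+ 2 * w4)
      *: ((2 * w4) *: dw1' + z2 *: dz1')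
  + (- 4 * w1 ^+ 2 * w4 - 4 * w2 ^+ 2 * w4 + 16 * w3 * w4 ^+ 2)
      *: ((2 * w3) *: dw1' + z1 *: dz2').

(* Main.v *)
(* The field X has components only along z1', z2', w1'. For fixed z1, z2, w1, ..., w4
   the quadric M is cut out by a real-affine equation in (z1', z2', w1'), so X is
   tangent to M at p as soon as the real line p + t X(p) stays in M, that is,
     Im X_{w1'} = z1 conj(X_{z2'}) + X_{z2'} conj(z1)
                  + z2 conj(X_{z1'}) + X_{z1'} conj(z2)   on M.
   The equations of M give conj(w_j) = w_j - 2i Im(w_j) with Im(w_j) a polynomial in
   z1, z2 and their conjugates, which makes this a polynomial identity modulo
   i^2 = -1. *)
Require Import Defs.
From mathcomp Require Import all_boot all_order all_algebra reals.
From HB Require Import structures.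
From mathcomp Require Import complex mpoly zify ring.
From mathcomp Require Import boolp classical_sets functions.
From mathcomp Require Import topology normedtype derive.

Set Implicit Arguments.
Unset Strict Implicit.
Unset Printing Implicit Defensive.

Import Order.TTheory GRing.Theory Num.Theory.
Import numFieldNormedType.Exports.
Local Open Scope classical_set_scope.
Local Open Scope ring_scope.

(** * Tangent vectors realised by straight lines *)

Lemma is_derive_affine (R : realType) (f : R -> R) (a b : R) :
  (forall t, f t = a + t * b) -> is_derive (0 : R) 1 f b.
Proof.
move=> fE; have -> : f = (fun t => a + t * b) by apply/funext.
by apply: is_derive_eq; rewrite ?scaler0 ?add0r /GRing.scale /= ?mulr1.
Qed.

Lemma tangent_vector_line (R : realType) (M : set (C9 R)) (p v : C9 R) :
  (forall t : R, M (p + (t%:C%C : Cplx R) *: v)) -> tangent_vector M p v.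
Proof.
move=> Mpv; exists (fun t => p + (t%:C%C : Cplx R) *: v); split.
- by rewrite scale0r addr0.
- by near=> t; exact: Mpv.
move=> j; split.
- apply: (@is_derive_affine _ _ (complex.Re (p 0 j))) => t; rewrite !mxE /=.
  by case: (p 0 j) => a b; case: (v 0 j) => c d /=; rewrite mul0r subr0.
- apply: (@is_derive_affine _ _ (complex.Im (p 0 j))) => t; rewrite !mxE /=.
  by case: (p 0 j) => a b; case: (v 0 j) => c d /=; rewrite mul0r addr0.
Unshelve. all: by end_near. Qed.

(** * Holomorphy of polynomial functions *)

Lemma differentiable_meval (R : realType) (q : {mpoly (Cplx R)[9]}) (x : C9 R) :
  differentiable (fun p : C9 R => q.@[fun i => p 0 i] : Cplx R) x.
Proof.
have coord i : differentiable (fun p : C9 R => p 0 i : Cplx R) x.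
  exact: (@differentiable_coord (Cplx R) 1 9).
elim/mpolyind: q => [|c m q _ _ IHq].
  under eq_fun do rewrite meval0.
  exact: differentiable_cst.
under eq_fun do rewrite mevalD mevalZ mevalX.
apply: (@differentiableD (Cplx R) (C9 R) (Cplx R)) IHq.
apply: (@differentiableM (Cplx R) (C9 R)); first exact: differentiable_cst.
(* The pointwise product of monomial factors becomes a product in the ring of functions, to which
   [big_ind] applies. *)
rewrite -[X in differentiable X _]fct_prodE.
elim/big_ind: _ => [|f g df dg|i _].
- exact: (@differentiable_cst (Cplx R) (C9 R) (Cplx R) 1).
- exact: (@differentiableM (Cplx R) (C9 R)).
- elim: (m i) => [|k IHk].
    exact: (@differentiable_cst (Cplx R) (C9 R) (Cplx R) 1).
  under eq_fun do rewrite exprS.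
  exact: (@differentiableM (Cplx R) (C9 R)).
Qed.

(** * Homogeneity with respect to a general degree function *)

Lemma dhomog_nat (n k : nat) (S : nzRingType) (mf : measure n) :
  (k%:R : {mpoly S[n]}) \is 0.-homog for mf.
Proof. exact/rpredMn/dhomog1. Qed.

Lemma dhomogC (n : nat) (S : nzRingType) (mf : measure n) (c : S) :
  (c%:MP : {mpoly S[n]}) \is 0.-homog for mf.
Proof. by rewrite -alg_mpolyC; apply/rpredZ/dhomog1. Qed.

Section Weighted.
Variables (n : nat) (wt : 'I_n -> nat).

(** Registered below as a [measure], so that the closure properties of [homog] serve the ordinary
    and the weighted degree alike. *)
Definition wdeg (m : 'X_{1..n}) : nat := (\sum_(i < n) m i * wt i)%N.

Lemma wdeg0 : wdeg 0%MM = 0%N.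
Proof. by rewrite /wdeg big1 // => i _; rewrite mnm0E. Qed.

Lemma wdegD : {morph wdeg : m1 m2 / (m1 + m2)%MM >-> (m1 + m2)%N}.
Proof.
move=> m1 m2; rewrite /wdeg -big_split /=.
by apply: eq_bigr => i _; rewrite mnmDE mulnDl.
Qed.

HB.instance Definition _ := isMeasure.Build n wdeg wdeg0 wdegD.

Lemma wdeg1 i : wdeg U_(i)%MM = wt i.
Proof.
rewrite /wdeg (bigD1 i) //= mnm1E eqxx mul1n big1 ?addn0 // => j /negbTE ji.
by rewrite mnm1E eq_sym ji.
Qed.

End Weighted.

(** Trades ['Im], which is only additive, for conjugation, a ring morphism that passes through
    polynomial expressions. *)
Lemma Im_eqP (C : numClosedFieldType) (x y : C) :
  x - x^* = 2 * 'i * y -> 'Im x = y.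
Proof.
move=> xy; have -> : 'Im x = - 'i * (x - x^*) / 2.
  by rewrite ImE; field.
by rewrite xy; field: (sqrCi C).
Qed.

Lemma conj_Im (C : numClosedFieldType) (x : C) : x^* = x - 2 * 'i * 'Im x.
Proof.
by rewrite ImE; field: (sqrCi C).
Qed.

(** * The coefficients of the field over a commutative ring *)

Section Coefficients.
Variable T : comNzRingType.
Implicit Types i z w : T.

(* quarticA, cubicB, ..., cubicE are the coefficients of the five summands of
   [explicit_field], over an arbitrary ring: at [{mpoly _[9]}] they give the
   field, at the complex numbers its values. *)
Definition quarticA w1 w2 w3 w4 :=
  - 3 * w1 ^+ 4 - 6 * w1 ^+ 2 * w2 ^+ 2 + 24 * w1 ^+ 2 * w3 * w4
  - 3 * w2 ^+ 4 + 24 * w2 ^+ 2 * w3 * w4 - 48 * w3 ^+ 2 * w4 ^+ 2.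

Definition cubicB w1 w2 w3 w4 :=
  2 * w1 ^+ 3 + 2 * w1 * w2 ^+ 2 - 8 * w1 * w3 * w4.

Definition cubicC w1 w2 w3 w4 :=
  2 * w1 ^+ 2 * w2 + 2 * w2 ^+ 3 - 8 * w2 * w3 * w4.

Definition cubicD w1 w2 w3 w4 :=
  - 4 * w1 ^+ 2 * w3 - 4 * w2 ^+ 2 * w3 + 16 * w3 ^+ 2 * w4.

Definition cubicE w1 w2 w3 w4 :=
  - 4 * w1 ^+ 2 * w4 - 4 * w2 ^+ 2 * w4 + 16 * w3 * w4 ^+ 2.

(** The imaginary unit is an argument [i], since it becomes ['i%:MP] among polynomials and [- 'i]
    under conjugation. *)
Definition coef_dz1' i z1 z2 w1 w2 w3 w4 :=
  cubicB w1 w2 w3 w4 * z1 - cubicC w1 w2 w3 w4 * (i * z1)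
  + cubicD w1 w2 w3 w4 * z2.

Definition coef_dz2' i z1 z2 w1 w2 w3 w4 :=
  cubicB w1 w2 w3 w4 * z2 + cubicC w1 w2 w3 w4 * (i * z2)
  + cubicE w1 w2 w3 w4 * z1.

Definition coef_dw1' w1 w2 w3 w4 :=
  quarticA w1 w2 w3 w4
  + cubicB w1 w2 w3 w4 * (2 * w1) + cubicC w1 w2 w3 w4 * (2 * w2)
  + cubicD w1 w2 w3 w4 * (2 * w4) + cubicE w1 w2 w3 w4 * (2 * w3).

Lemma field_coef i z1 z2 w1 w2 w3 w4 :
  let d j : 'rV[T]_9 := delta_mx 0 j in
  let X := quarticA w1 w2 w3 w4 *: d iw1'
    + cubicB w1 w2 w3 w4 *: ((2 * w1) *: d iw1' + z1 *: d iz1' + z2 *: d iz2')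
    + cubicC w1 w2 w3 w4
        *: ((2 * w2) *: d iw1' - (i * z1) *: d iz1' + (i * z2) *: d iz2')
    + cubicD w1 w2 w3 w4 *: ((2 * w4) *: d iw1' + z2 *: d iz1')
    + cubicE w1 w2 w3 w4 *: ((2 * w3) *: d iw1' + z1 *: d iz2') in
  [/\ X 0 iz1' = coef_dz1' i z1 z2 w1 w2 w3 w4,
      X 0 iz2' = coef_dz2' i z1 z2 w1 w2 w3 w4,
      X 0 iw1' = coef_dw1' w1 w2 w3 w4
    & forall j, j \notin [:: iz1'; iz2'; iw1'] -> X 0 j = 0].
Proof.
move=> d X; split; rewrite /X /d.
- by rewrite !mxE /= !(mulr0, mulr1, add0r, addr0, mulrN).
- by rewrite !mxE /= !(mulr0, mulr1, add0r, addr0, oppr0).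
- by rewrite !mxE /= !(mulr0, mulr1, add0r, addr0, oppr0).
move=> j; rewrite !inE !negb_or => /and3P[/negbTE j1 /negbTE j2 /negbTE j3].
by rewrite !mxE /= j1 j2 j3 !(mulr0, mulr1, add0r, addr0, oppr0).
Qed.

(** On the [w1]-axis only [quarticA] and [cubicB] contribute: -3w^4 + 2w^3 * 2w = w^4. This shows
    that the field does not vanish. *)
Lemma coef_dw1'_w1 w : coef_dw1' w 0 0 0 = w ^+ 4.
Proof. by rewrite /coef_dw1' /quarticA /cubicB /cubicC /cubicD /cubicE; ring. Qed.

End Coefficients.

Section CoefficientsMorphism.
Variables (T S : comNzRingType) (f : {rmorphism T -> S}).

(** Used for two morphisms: evaluation of polynomials at a point, and complex conjugation. *)
Lemma rmorph_coef_dz1' i z1 z2 w1 w2 w3 w4 :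
  f (coef_dz1' i z1 z2 w1 w2 w3 w4) =
  coef_dz1' (f i) (f z1) (f z2) (f w1) (f w2) (f w3) (f w4).
Proof.
rewrite /coef_dz1' /cubicB /cubicC /cubicD.
by rewrite !(rmorph_nat, rmorphXn, rmorphM, rmorphN, rmorphD).
Qed.

Lemma rmorph_coef_dz2' i z1 z2 w1 w2 w3 w4 :
  f (coef_dz2' i z1 z2 w1 w2 w3 w4) =
  coef_dz2' (f i) (f z1) (f z2) (f w1) (f w2) (f w3) (f w4).
Proof.
rewrite /coef_dz2' /cubicB /cubicC /cubicE.
by rewrite !(rmorph_nat, rmorphXn, rmorphM, rmorphN, rmorphD).
Qed.

Lemma rmorph_coef_dw1' w1 w2 w3 w4 :
  f (coef_dw1' w1 w2 w3 w4) = coef_dw1' (f w1) (f w2) (f w3) (f w4).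
Proof.
rewrite /coef_dw1' /quarticA /cubicB /cubicC /cubicD /cubicE.
by rewrite !(rmorph_nat, rmorphXn, rmorphM, rmorphN, rmorphD).
Qed.

End CoefficientsMorphism.

(** * Values of the explicit field and the tangency identity *)

Lemma explicit_field_coef (R : realType) :
  let X := explicit_field R in
  [/\ X 0 iz1' = coef_dz1' 'i%:MP 'X_iz1 'X_iz2 'X_iw1 'X_iw2 'X_iw3 'X_iw4,
      X 0 iz2' = coef_dz2' 'i%:MP 'X_iz1 'X_iz2 'X_iw1 'X_iw2 'X_iw3 'X_iw4,
      X 0 iw1' = coef_dw1' 'X_iw1 'X_iw2 'X_iw3 'X_iw4
    & forall j, j \notin [:: iz1'; iz2'; iw1'] -> X 0 j = 0].
Proof. exact: (@field_coef {mpoly (Cplx R)[9]}). Qed.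

Lemma eval_explicit_field (R : realType) (p : C9 R) :
  let X := eval_field (explicit_field R) p in
  let z1 := p 0 iz1 in let z2 := p 0 iz2 in
  let w1 := p 0 iw1 in let w2 := p 0 iw2 in
  let w3 := p 0 iw3 in let w4 := p 0 iw4 in
  [/\ X 0 iz1' = coef_dz1' 'i z1 z2 w1 w2 w3 w4,
      X 0 iz2' = coef_dz2' 'i z1 z2 w1 w2 w3 w4,
      X 0 iw1' = coef_dw1' w1 w2 w3 w4
    & forall j, j \notin [:: iz1'; iz2'; iw1'] -> X 0 j = 0].
Proof.
have [e1 e2 e3 e4] := explicit_field_coef R.
split; [rewrite mxE e1|rewrite mxE e2|rewrite mxE e3|].
- by rewrite rmorph_coef_dz1' /= mevalC !mevalXU.
- by rewrite rmorph_coef_dz2' /= mevalC !mevalXU.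
- by rewrite rmorph_coef_dw1' /= !mevalXU.
by move=> j jn; rewrite mxE e4 // meval0.
Qed.

Lemma Im_coef_dw1' (C : numClosedFieldType) (z1 z2 w1 w2 w3 w4 : C) :
    'Im w1 = z1 * z2^* + z2 * z1^* ->
    'Im w2 = - 'i * z1 * z2^* + 'i * z2 * z1^* ->
    'Im w3 = z1 * z1^* ->
    'Im w4 = z2 * z2^* ->
  let X1 := coef_dz1' 'i z1 z2 w1 w2 w3 w4 in
  let X2 := coef_dz2' 'i z1 z2 w1 w2 w3 w4 in
  'Im (coef_dw1' w1 w2 w3 w4) =
  z1 * X2^* + X2 * z1^* + z2 * X1^* + X1 * z2^*.
Proof.
move=> h1 h2 h3 h4 X1 X2; apply: Im_eqP.
rewrite /X1 /X2 rmorph_coef_dz1' rmorph_coef_dz2' rmorph_coef_dw1' /= conjCi.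
rewrite (conj_Im w1) (conj_Im w2) (conj_Im w3) (conj_Im w4) h1 h2 h3 h4.
(* No conjugate of a [w] is left: both sides are polynomials in the [w]'s, [z1], [z2], [z1^*],
   [z2^*] and ['i], and they agree modulo ['i ^+ 2 = -1]. *)
rewrite /coef_dz1' /coef_dz2' /coef_dw1'.
rewrite /quarticA /cubicB /cubicC /cubicD /cubicE.
ring: (sqrCi C).
Qed.

(** * Homogeneity of the coefficients *)

Lemma dhomogN_nat (n k : nat) (S : nzRingType) (mf : measure n) :
  (- k%:R : {mpoly S[n]}) \is 0.-homog for mf.
Proof. by rewrite rpredN dhomog_nat. Qed.

(** Separates the degree [d] read off from the shape of a product from the expected degree [e];
    their equality is then plain arithmetic. *)
Lemma dhomog_eq (n : nat) (S : nzRingType) (mf : measure n) (d e : nat)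
    (p : {mpoly S[n]}) :
  p \is d.-homog for mf -> d = e -> p \is e.-homog for mf.
Proof. by move=> ? <-. Qed.

Ltac homog_prod := lazymatch goal with
  | |- is_true (in_mem (@GRing.mul _ _ _) _) => apply: dhomogM; homog_prod
  | |- is_true (in_mem (@GRing.exp _ _ _) _) => apply: dhomogMn; homog_prod
  | |- is_true (in_mem (@Algebra.opp _ _) _) => exact: dhomogN_nat
  | |- is_true (in_mem (@Algebra.natmul _ _ _) _) => exact: dhomog_nat
  | |- _ => eassumption
  end.

Ltac solve_homog := lazymatch goal with
  | |- is_true (in_mem (@Algebra.add _ _ (@Algebra.opp _ _)) _) =>
     apply: rpredB; solve_homog
  | |- is_true (in_mem (@Algebra.add _ _ _) _) => apply: rpredD; solve_homog
  | |- is_true (in_mem (@GRing.mul _ _ _) _) =>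
     eapply dhomog_eq; [apply: dhomogM; homog_prod | clear; lia]
  end.

(** Covers both gradings at once: d = e = 1 gives ordinary degree 4 throughout, while d = 1, e = 2
    gives weighted degrees 7, 7 and 8. *)
Lemma dhomog_coef (n : nat) (S : comNzRingType) (mf : measure n) (d e : nat)
    (i z1 z2 w1 w2 w3 w4 : {mpoly S[n]}) :
    i \is 0.-homog for mf ->
    z1 \is d.-homog for mf -> z2 \is d.-homog for mf ->
    w1 \is e.-homog for mf -> w2 \is e.-homog for mf ->
    w3 \is e.-homog for mf -> w4 \is e.-homog for mf ->
  [/\ coef_dz1' i z1 z2 w1 w2 w3 w4 \is (3 * e + d).-homog for mf,
      coef_dz2' i z1 z2 w1 w2 w3 w4 \is (3 * e + d).-homog for mf
    & coef_dw1' w1 w2 w3 w4 \is (4 * e).-homog for mf].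
Proof.
move=> hi hz1 hz2 hw1 hw2 hw3 hw4.
have hB : cubicB w1 w2 w3 w4 \is (3 * e).-homog for mf.
  by rewrite /cubicB; solve_homog.
have hC : cubicC w1 w2 w3 w4 \is (3 * e).-homog for mf.
  by rewrite /cubicC; solve_homog.
have hD : cubicD w1 w2 w3 w4 \is (3 * e).-homog for mf.
  by rewrite /cubicD; solve_homog.
have hE : cubicE w1 w2 w3 w4 \is (3 * e).-homog for mf.
  by rewrite /cubicE; solve_homog.
rewrite /coef_dz1' /coef_dz2' /coef_dw1' /quarticA.
move: (cubicB _ _ _ _) (cubicC _ _ _ _) (cubicD _ _ _ _) (cubicE _ _ _ _)
  hB hC hD hE => B C D E hB hC hD hE.
by split; solve_homog.
Qed.

(** * The required properties of the explicit field *)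

Lemma explicit_field_tangent (R : realType) (p : C9 R) :
  quadricM R p ->
  tangent_vector (quadricM R) p (real_part (eval_field (explicit_field R)) p).
Proof.
move=> [h1 h2 h3 h4 h5]; have [e1 e2 e3 e4] := eval_explicit_field p.
have hX := Im_coef_dw1' h1 h2 h3 h4; rewrite /= -e1 -e2 -e3 in hX.
apply: tangent_vector_line => t; rewrite /real_part scalerA.
move: (eval_field _ p) hX e4 => X hX e4 {e1 e2 e3}.
(* The factor 1/2 comes from [real_part]. Only the reality of the scalar matters from here on. *)
have : (t%:C%C : Cplx R) / 2 \is Num.real.
  by apply: realM; [rewrite complex_real | rewrite realV realn].
move: (_ / 2) => s rs.
have fixed j : j \notin [:: iz1'; iz2'; iw1'] -> (p + s *: X) 0 j = p 0 j.
  by move=> /e4 Xj; rewrite !mxE Xj mulr0 addr0.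
have moved j : (p + s *: X) 0 j = p 0 j + s * X 0 j by rewrite !mxE.
rewrite /quadricM /=; split.
1-4: by rewrite !fixed.
rewrite (fixed iz1) // (fixed iz2) // !moved.
(* For real [s] the last equation at the moved point is [h5] plus [s] times the tangency identity
   [hX]. *)
rewrite raddfD /= ImMl // h5 hX !rmorphD !rmorphM /= (conj_Creal rs).
ring.
Qed.

(** Along the [w1]-axis the [w1']-component is t^4, which is nonzero at points arbitrarily close to
    0. *)
Lemma explicit_field_nonzero (R : realType) :
  nonzero_germ (eval_field (explicit_field R)).
Proof.
move=> X0; pose l (t : Cplx R) : C9 R := t *: delta_mx 0 iw1.
have cl : l t @[t --> (0 : Cplx R)] --> (0 : C9 R).
  rewrite -(scale0r (delta_mx 0 iw1 : C9 R)).
  exact: (@scalel_continuous (Cplx R) (C9 R)).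
have {cl X0} : \forall t \near (0 : Cplx R)^',
    eval_field (explicit_field R) (l t) = 0.
  exact/nbhs_dnbhs/(cl _ X0).
(* Punctured neighbourhoods of 0 form a proper filter, so some nonzero [t] has the field vanishing
   at [l t]. *)
move=> Xl; have : \forall t \near (0 : Cplx R)^', t != 0 by exact: nbhs_dnbhs_neq.
move=> /(filterI Xl) /filter_ex[t [Xlt /negP]]; apply; move: Xlt.
have [_ _ + _] := eval_explicit_field (l t).
have lE j : l t 0 j = t * (j == iw1)%:R by rewrite !mxE.
rewrite !lE /= !(mulr0, mulr1) coef_dw1'_w1 => + Xlt.
by rewrite Xlt mxE => /esym/eqP; rewrite expf_eq0.
Qed.

Lemma explicit_field_homogeneous (R : realType) :
  homogeneous_coefficients 4 (explicit_field R).
Proof.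
have [e1 e2 e3 e4] := explicit_field_coef R.
have X1 j : ('X_j : {mpoly (Cplx R)[9]}) \is 1.-homog.
  by rewrite dhomogX; apply/eqP/mdeg1.
have [h1 h2 h3] := dhomog_coef (dhomogC _ 'i) (X1 iz1) (X1 iz2)
  (X1 iw1) (X1 iw2) (X1 iw3) (X1 iw4).
move=> j; have [/e4 ->|] := boolP (j \notin [:: iz1'; iz2'; iw1']).
  exact: rpred0.
by rewrite negbK !inE => /or3P[] /eqP ->; rewrite ?e1 ?e2 ?e3.
Qed.

Lemma explicit_field_weighted (R : realType) :
  weighted_homogeneous 6 (explicit_field R).
Proof.
have [e1 e2 e3 e4] := explicit_field_coef R.
have Xw j : ('X_j : {mpoly (Cplx R)[9]}) \is (weight j).-homog for (wdeg weight).
  by rewrite dhomogX; apply/eqP/wdeg1.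
have [h1 h2 h3] := dhomog_coef (dhomogC _ 'i) (Xw iz1) (Xw iz2)
  (Xw iw1) (Xw iw2) (Xw iw3) (Xw iw4).
move=> j m; have [/e4 ->|] := boolP (j \notin [:: iz1'; iz2'; iw1']).
  by rewrite msupp0.
rewrite negbK !inE => /or3P[] /eqP ->; rewrite ?e1 ?e2 ?e3.
(* Subtracting the weight of the coordinate gives 7 - 1 for [z1'] and [z2'], and 8 - 2 for [w1']. *)
- by move=> /(dhomog_mf h1); rewrite /= /wdeg => ->.
- by move=> /(dhomog_mf h2); rewrite /= /wdeg => ->.
- by move=> /(dhomog_mf h3); rewrite /= /wdeg => ->.
Qed.

Lemma eval_field_differentiable (R : realType) (X : poly_field R) (p : C9 R) :
  differentiable (eval_field X) p.
Proof.
(* Expansion in the standard basis reduces holomorphy to the scalar components. *)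
have -> : eval_field X =
    \sum_(j < 9) (fun q : C9 R =>
      (X 0 j).@[fun i => q 0 i] *: (delta_mx 0 j : C9 R)).
  apply/funext => q; rewrite fct_sumE [LHS]row_sum_delta.
  by apply: eq_bigr => j _; rewrite mxE.
apply: differentiable_sum => j.
exact/differentiableZl/differentiable_meval.
Qed.

Theorem mainTheorem2 (R : realType) :
  (exists X : poly_field R,
     [/\ nonzero_germ (eval_field X),
         infinitesimal_CR_automorphism (quadricM R) (eval_field X),
         weighted_homogeneous 6 X
       & homogeneous_coefficients 4 X]) /\
  [/\ nonzero_germ (eval_field (explicit_field R)),
      infinitesimal_CR_automorphism (quadricM R) (eval_field (explicit_field R)),
      weighted_homogeneous 6 (explicit_field R)
    & homogeneous_coefficients 4 (explicit_field R)].
Proof.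
suff H : [/\ nonzero_germ (eval_field (explicit_field R)),
    infinitesimal_CR_automorphism (quadricM R) (eval_field (explicit_field R)),
    weighted_homogeneous 6 (explicit_field R)
  & homogeneous_coefficients 4 (explicit_field R)].
  by split=> //; exists (explicit_field R).
split; last exact: explicit_field_homogeneous.
- exact: explicit_field_nonzero.
- split; first by near=> p; exact: eval_field_differentiable.
  by near=> p; exact: explicit_field_tangent.
- exact: explicit_field_weighted.
Unshelve. all: by end_near. Qed.
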